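(* The minimum size $f(d)$ of a double cover of $\{0,1,2\}^d$ satisfies $f(6)\le 81$, and $$f(d)\le\left(\tfrac65+o(1)\right)2^d\qquad (d\to\infty),$$ i.e. $\limsup_{d\to\infty} f(d)/2^d\le \tfrac65$.
   Context: Write $[3]=\{0,1,2\}$. A proper sub-box of $[3]^d$ is a set $B=S_1\times\dots\times S_d$ with $\varnothing\neq S_i\subsetneq[3]$ for every $1\le i\le d$ (so each side $S_i$ has one or two elements). A double cover of $[3]^d$ is a finite multiset $\{B_1,\dots,B_m\}$ of proper sub-boxes such that every point of $[3]^d$ lies in exactly two of the $B_j$, counted with multiplicity; its size is $m$. $f(d)$ denotes the minimum size of a double cover of $[3]^d$. It is known from earlier work that $[3]^3$ has a double cover with $11$ boxes. *)

(* Defs.v *)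
From mathcomp Require Import all_boot.

Set Implicit Arguments.
Unset Strict Implicit.
Unset Printing Implicit Defensive.

Definition point (d : nat) := {ffun 'I_d -> 'I_3}.

Definition box (d : nat) (S : {ffun 'I_d -> {set 'I_3}}) : {set point d} :=
  [set x : point d | [forall i, x i \in S i]].

Definition proper_box (d : nat) (B : {set point d}) : bool :=
  [exists S : {ffun 'I_d -> {set 'I_3}},
    [forall i, (S i != set0) && (S i \proper [set: 'I_3])] && (B == box S)].

(* A finite multiset of boxes is represented by a sequence listing its members
   with multiplicity; the order is irrelevant to the notions below. *)
Definition double_cover (d : nat) (Bs : seq {set point d}) : bool :=
  all (@proper_box d) Bs &&
  [forall x : point d, count (fun B : {set point d} => x \in B) Bs == 2].

Definition double_cover_size (d m : nat) : bool :=
  [exists Bs : m.-tuple {set point d}, double_cover Bs].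

(* Twice the partition into the 2 ^ d boxes with all sides {0} or {1, 2}. *)
Lemma double_cover_size_exists (d : nat) : exists m, double_cover_size d m.
Proof.
pose S (b : {ffun 'I_d -> bool}) : {ffun 'I_d -> {set 'I_3}} :=
  [ffun i => if b i then [set ord0] else ~: [set ord0]].
pose s := [seq box (S b) | b <- enum {ffun 'I_d -> bool}].
exists (size (s ++ s)); apply/existsP; exists (in_tuple (s ++ s)).
apply/andP; split.
- have sP : all (@proper_box d) s.
    apply/allP => _ /mapP[b _ ->]; apply/existsP; exists (S b).
    rewrite eqxx andbT; apply/forallP => i; rewrite ffunE properE subsetT /=.
    case: (b i); apply/andP; split.
    + by apply/set0Pn; exists ord0; rewrite inE.
    + by apply/subsetPn; exists ord_max; rewrite !inE.
    + by apply/set0Pn; exists ord_max; rewrite !inE.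
    + by apply/subsetPn; exists ord0; rewrite !inE.
  by rewrite all_cat sP.
- apply/forallP => x.
  suff c1 : count (fun B : {set point d} => x \in B) s = 1.
    by rewrite count_cat c1.
  rewrite count_map.
  pose b0 : {ffun 'I_d -> bool} := [ffun i => x i == ord0].
  have cb : count_mem b0 (enum {ffun 'I_d -> bool}) = 1.
    by rewrite count_uniq_mem ?enum_uniq // mem_enum.
  apply: etrans cb; apply: eq_count => b /=.
  rewrite !inE; apply/forallP/eqP => [xS|-> i].
  + apply/ffunP => i; move: (xS i); rewrite !ffunE.
    by case: (b i); rewrite !inE // => /negbTE.
  + by rewrite !ffunE; case: ifPn; rewrite !inE.
Qed.

Definition min_double_cover (d : nat) : nat := ex_minn (double_cover_size_exists d).

(* Main.v *)
Require Import Defs.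
From mathcomp Require Import all_boot all_order all_algebra.
From mathcomp Require Import all_classical all_reals all_analysis.
From mathcomp Require Import zify ring lra.

(**
  Suppose [3]^k carries proper boxes A_1, ..., A_a and B_1, ..., B_b such that
  every point x satisfies #{i | x \in A_i} + 2 #{i | x \in B_i} = 2.  Crossing
  each A_i with a partition of [3]^d into 2^d proper boxes, and each B_i with a
  double cover of [3]^d, gives f(k + d) <= a 2^d + b f(d).

  - k = 1: A = {01, 02, 12}, B empty, so f(1) <= 3 and f(2) <= 6.
  - k = 2: the four boxes 01 x 02, 01 x 12, 02 x 01, 12 x 01 cover every point
    but (2, 2) twice, so f(3) <= 4 * 2 + f(1) <= 11.
  - k = 3: the six boxes [3]-{s 0} x [3]-{s 1} x [3]-{s 2}, for s a permutation
    of [3], cover every nonconstant point twice and miss the three constant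
    ones, so f(d + 3) <= 6 * 2^d + 3 f(d); in particular f(6) <= 48 + 33 = 81.

  The last recurrence multiplies the excess f(d) - (6/5) 2^d by at most 3 while
  2^d grows by a factor 8, so the excess is o(2^d).
*)

Set Implicit Arguments.
Unset Strict Implicit.
Unset Printing Implicit Defensive.

Import Order.TTheory GRing.Theory Num.Theory.
Import numFieldNormedType.Exports.
Local Open Scope ring_scope.

Section BoxCodes.

Local Open Scope nat_scope.

(* Points and boxes are encoded by lists of coordinates and of sides: covers of
   small grids are then checked by computation, and products are [++]. *)
Definition point_code (d : nat) (x : seq nat) :=
  (size x == d) && all (fun a => a < 3) x.

(** A list stands for its trace on [3]: order, repetitions and entries above 2 do not matter. *)
Definition proper_side (s : seq nat) :=
  has (mem s) (iota 0 3) && ~~ all (mem s) (iota 0 3).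

Definition box_code (d : nat) (b : seq (seq nat)) :=
  (size b == d) && all proper_side b.

Definition in_box (x : seq nat) (b : seq (seq nat)) :=
  all2 (fun a (s : seq nat) => a \in s) x b.

(** The multiplicity [k] is 1 for partitions and 2 for double covers. *)
Definition code_cover (k d : nat) (L : seq (seq (seq nat))) :=
  all (box_code d) L /\
  forall x, point_code d x -> count (in_box x) L = k.

Definition box_product (A L : seq (seq (seq nat))) := [seq a ++ b | a <- A, b <- L].

Lemma in_box_cat x y a b : size x = size a ->
  in_box (x ++ y) (a ++ b) = in_box x a && in_box y b.
Proof.
move=> sxa; rewrite /in_box !all2E !size_cat sxa eqn_add2l eqxx /=.
by rewrite zip_cat // all_cat andbCA.
Qed.

Lemma box_product_code k d A L : all (box_code k) A -> all (box_code d) L ->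
  all (box_code (k + d)) (box_product A L).
Proof.
move=> /allP Ak /allP Ld; apply/allP => _ /allpairsP[[a b] /= [aA bL ->]].
have /andP[/eqP ska apr] := Ak _ aA; have /andP[/eqP sdb bpr] := Ld _ bL.
by rewrite /box_code size_cat ska sdb eqxx all_cat apr bpr.
Qed.

Lemma count_box_product k A L x y : all (box_code k) A -> size x = k ->
  count (in_box (x ++ y)) (box_product A L)
    = count (in_box x) A * count (in_box y) L.
Proof.
move=> + sx; elim: A => [|a A IHA] //= /andP[/andP[/eqP sa _] Ak].
rewrite /box_product /= count_cat -/(box_product A L) IHA // mulnDl count_map.
congr (_ + _); under eq_count => b do rewrite /= in_box_cat ?sa //.
by case: (in_box x a); rewrite ?mul1n // mul0n count_pred0.
Qed.

Lemma point_code_cat k d z : point_code (k + d) z ->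
  exists x y, [/\ z = x ++ y, point_code k x & point_code d y].
Proof.
move=> /andP[/eqP sz]; rewrite -{1}(cat_take_drop k z) all_cat => /andP[zk zd].
exists (take k z), (drop k z); split; first by rewrite cat_take_drop.
  by rewrite /point_code zk size_takel ?eqxx // sz leq_addr.
by rewrite /point_code zd size_drop sz addKn eqxx.
Qed.

Lemma code_partition d : exists2 P, code_cover 1 d P & size P = 2 ^ d.
Proof.
elim: d => [|d [P [Pd P1] sP]].
  by exists [:: [::]] => //; split => // x /andP[/nilP -> _].
have Ad : all (box_code 1) [:: [:: [:: 0]]; [:: [:: 1; 2]]] by [].
exists (box_product [:: [:: [:: 0]]; [:: [:: 1; 2]]] P); last first.
  by rewrite size_allpairs sP expnS.
split=> [|z]; first exact: box_product_code Ad Pd.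
move=> /(@point_code_cat 1)[x [y [-> /andP[/eqP sx x3] yd]]].
rewrite (count_box_product _ _ Ad sx) P1 // muln1.
(* The case split runs through the points 0, 1, 2 of [3]; any other list fails the length or the
   range test. *)
by case: x sx x3 => [|[|[|[|a]]] []].
Qed.

Lemma code_cover_glue k d A B L :
  all (box_code k) A -> all (box_code k) B ->
  (forall x, point_code k x -> count (in_box x) A + 2 * count (in_box x) B = 2) ->
  code_cover 2 d L ->
  exists2 L', code_cover 2 (k + d) L' & size L' = size A * 2 ^ d + size B * size L.
Proof.
move=> Ak Bk AB2 [Ld L2]; have [P [Pd P1] sP] := code_partition d.
exists (box_product A P ++ box_product B L); last first.
  by rewrite size_cat !size_allpairs sP.
split=> [|z /point_code_cat[x [y [-> xk yd]]]].
  by rewrite all_cat !box_product_code.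
have /andP[/eqP sx _] := xk.
(* Multiplicities multiply: [P] contributes a factor 1 and [L] a factor 2, which leaves the weighted
   count of [x] assumed to be 2. *)
by rewrite count_cat !(count_box_product _ _ _ sx) // P1 // L2 // muln1 mulnC
           [X in _ + X]mulnC mulnC AB2.
Qed.

Lemma code_cover_add1 d L : code_cover 2 d L ->
  exists2 L', code_cover 2 d.+1 L' & size L' = 3 * 2 ^ d.
Proof.
move=> Ld; pose A := [:: [:: [:: 0; 1]]; [:: [:: 0; 2]]; [:: [:: 1; 2]]].
rewrite -[3 * 2 ^ d]addn0; apply: (@code_cover_glue 1 d A [::] L) => // x.
by case: x => [|[|[|[|a]]] []].
Qed.

Lemma code_cover_add2 d L : code_cover 2 d L ->
  exists2 L', code_cover 2 d.+2 L' & size L' = 4 * 2 ^ d + size L.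
Proof.
move=> Ld; pose A := [:: [:: [:: 0; 1]; [:: 0; 2]]; [:: [:: 0; 1]; [:: 1; 2]];
                         [:: [:: 0; 2]; [:: 0; 1]]; [:: [:: 1; 2]; [:: 0; 1]]].
rewrite -[size L]mul1n.
apply: (@code_cover_glue 2 d A [:: [:: [:: 2]; [:: 2]]] L) => // x.
by case: x => [|[|[|[|a]]] [|[|[|[|b]]] []]].
Qed.

Lemma code_cover_add3 d L : code_cover 2 d L ->
  exists2 L', code_cover 2 d.+3 L' & size L' = 6 * 2 ^ d + 3 * size L.
Proof.
move=> Ld.
pose A := [seq [seq rem a (iota 0 3) | a <- s] | s <- permutations (iota 0 3)].
pose B := [seq nseq 3 [:: a] | a <- iota 0 3].
apply: (@code_cover_glue 3 d A B L) => // x.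
by case: x => [|[|[|[|a]]] [|[|[|[|b]]] [|[|[|[|c]]] []]]].
Qed.

Lemma code_cover0 : code_cover 2 0 [:: [::]; [::]].
Proof. by split => // x /andP[/nilP -> _]. Qed.

(** Transfers covers by codes to covers by sets: decoding each list keeps the number of boxes and
    the multiplicity of every point. *)
Lemma min_double_cover_le d L : code_cover 2 d L -> min_double_cover d <= size L.
Proof.
move=> [/allP Ld L2]; rewrite /min_double_cover; case: ex_minnP => m _; apply.
(* The default [[::]] is never reached for [b] in [L], which has exactly [d] sides. *)
pose S (b : seq (seq nat)) : {ffun 'I_d -> {set 'I_3}} :=
  [ffun i : 'I_d => [set j : 'I_3 | (j : nat) \in nth [::] b i]].
apply/existsP; exists (map_tuple (fun b => box (S b)) (in_tuple L)).
apply/andP; split.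
  apply/allP => _ /mapP[b bL ->]; apply/existsP; exists (S b); rewrite eqxx andbT.
  have /andP[/eqP sb /allP bpr] := Ld _ bL.
  apply/forallP => i; rewrite ffunE properE finset.subsetT /=.
  have /andP[/hasP[a a3 ab] /allPn[c c3 cb]] : proper_side (nth [::] b i).
    by apply: bpr; rewrite mem_nth // sb.
  rewrite !mem_iota /= in a3 c3.
  apply/andP; split.
    by apply/set0Pn; exists (Ordinal a3); rewrite inE.
  by apply/subsetPn; exists (Ordinal c3); rewrite !inE.
apply/forallP => x; rewrite count_map; apply/eqP.
pose xc := [seq (x i : nat) | i <- enum 'I_d].
have sxc : size xc = d by rewrite size_map size_enum_ord.
have xcE (i : 'I_d) : nth 0 xc i = x i.
  by rewrite (nth_map i) ?size_enum_ord // nth_ord_enum.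
have xcP : point_code d xc.
  by rewrite /point_code sxc eqxx; apply/allP => _ /mapP[i _ ->].
apply: etrans (L2 _ xcP); apply: eq_in_count => b /Ld /andP[/eqP sb _] /=.
rewrite inE /in_box all2E sxc sb eqxx /=.
apply/forallP/(all_nthP (0, [::])) => [xS i|xS i].
  rewrite size_zip sxc sb minnn => id; rewrite nth_zip ?sxc ?sb //=.
  by have := xS (Ordinal id); rewrite ffunE inE -xcE.
have := xS i; rewrite size_zip sxc sb minnn nth_zip ?sxc ?sb //= xcE.
by move=> /(_ (ltn_ord i)); rewrite ffunE inE.
Qed.

(** Divided by [5 * 4 ^ d], the bound reads 6/5 + (3/4)^d. The excess (3/2)^d allowed over (6/5) 2^d
    grows by 27/8 in three dimensions, which absorbs the factor 3 of the recurrence. *)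
Lemma code_cover_excess d :
  exists2 L, code_cover 2 d L & 5 * size L * 2 ^ d <= 6 * 4 ^ d + 5 * 3 ^ d.
Proof.
have [L1 L1c sL1] := code_cover_add1 code_cover0.
have [L2 L2c sL2] := code_cover_add1 L1c.
elim/ltn_ind: d => -[|[|[|d]]] IHd.
- by exists [:: [::]; [::]] => //; exact: code_cover0.
- by exists L1 => //; rewrite sL1.
- by exists L2 => //; rewrite sL2.
have [|L Lc Ls] := IHd d; first by lia.
have [L' L'c sL'] := code_cover_add3 Lc; exists L'; rewrite // {}sL'.
have four : 4 ^ d = 2 ^ d * 2 ^ d by rewrite -expnMn.
(* Taking [Ls] 24 times suffices: the coefficients compare as 240 + 144 = 6 * 64 for [4 ^ d] and 120
   <= 5 * 27 for [3 ^ d]. *)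
by move: Ls; rewrite !expnS four; nia.
Qed.

Lemma min_double_cover6 : min_double_cover 6 <= 81.
Proof.
(* Dimensions 0, 1, 3, 6 with sizes 2, 3, 11, 81. *)
have [L1 L1c sL1] := code_cover_add1 code_cover0.
have [L3 L3c sL3] := code_cover_add2 L1c.
have [L6 L6c sL6] := code_cover_add3 L3c.
by have := min_double_cover_le L6c; rewrite sL6 sL3 sL1.
Qed.

End BoxCodes.

(** Tail suprema are monotone in the sequence, and those of the convergent [v] tend to [l]. *)
Lemma limn_esup_le_cvg_bound (R : realType) (u v : (\bar R)^nat) (l : \bar R) :
  (forall n, (u n <= v n)%E) -> (v n @[n --> \oo] --> l)%classic ->
  (limn_esup u <= l)%E.
Proof.
move=> uv vl; have /cvg_lim <- // := cvg_esups vl; rewrite limn_esup_lim.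
apply: lee_lim; [exact: is_cvg_esups|exact: is_cvg_esups|apply: nearW => n].
apply: ge_ereal_sup => _ [m nm <-]; apply: le_trans (uv m) _.
by apply: ereal_sup_ubound; exists m.
Qed.

Lemma min_double_cover_ratio (R : realType) (d : nat) :
  (min_double_cover d)%:R / 2 ^+ d <= 6 / 5 + (3 / 4) ^+ d :> R.
Proof.
have [L Lc Ls] := code_cover_excess d; have fL := min_double_cover_le Lc.
have p2 : 0 < 2 ^+ d :> R by rewrite exprn_gt0.
have E4 : 4 ^+ d = 2 ^+ d * 2 ^+ d :> R by rewrite -exprMn -natrM.
have : (5 * min_double_cover d * 2 ^ d <= 6 * 4 ^ d + 5 * 3 ^ d)%N.
  by apply: leq_trans Ls; rewrite leq_mul2r leq_mul2l fL !orbT.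
rewrite -(ler_nat R) !natrD !natrM !natrX E4 => h.
rewrite ler_pdivrMr // expr_div_n E4 -(ler_pM2r p2).
have -> : (6 / 5 + 3 ^+ d / (2 ^+ d * 2 ^+ d)) * 2 ^+ d * 2 ^+ d
  = 6 / 5 * (2 ^+ d * 2 ^+ d) + 3 ^+ d :> R by field; rewrite gt_eqF.
lra.
Qed.

Theorem corollary7p2 (R : realType) :
  (min_double_cover 6 <= 81)%N /\
  (limn_esup (fun d : nat => 
     ((min_double_cover d)%:R / 2 ^+ d : R)%:E) <= (6 / 5 : R)%:E)%E.
Proof.
split; first exact: min_double_cover6.
apply: (@limn_esup_le_cvg_bound _ _ (fun d => (6 / 5 + (3 / 4) ^+ d)%:E)).
  by move=> d; rewrite lee_fin; exact: min_double_cover_ratio.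
have lim65 : ((6 / 5 + (3 / 4) ^+ d : R) @[d --> \oo] --> (6 / 5 : R))%classic.
  rewrite -[X in (_ --> X)%classic]addr0; apply: cvgD; first exact: cvg_cst.
  by apply: cvg_expr; rewrite ger0_norm; lra.
by apply: cvg_EFin; [exact: nearW|exact: lim65].
Qed.
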